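(* Let $\psi\in\mathrm{Isom}(\mathbb{E})$ be an elliptic isometry of three-dimensional Minkowski space without fixed points. Then $$\mathcal{T}(\langle\psi\rangle)=\mathbb{E},$$ and the CTC region of $\mathbb{E}/\langle\psi\rangle$ is the entire space.
   Context: $\mathbb{E}$ is the affine space modeled on $\mathbb{R}^{2,1}=\mathbb{R}^3$ with the form $\mathbb{B}((x,y,z),(u,v,w))=xu+yv-zw$. A vector $v$ is timelike if $\mathbb{B}(v,v)<0$. $\mathrm{Isom}(\mathbb{E})$ is the group of affine isometries $\gamma(p)=g(p)+v$, with linear part $g\in \mathrm{O}(2,1)$ and translational part $v\in\mathbb{R}^{2,1}$; only isometries preserving orientation and time-orientation (linear part in the identity component of $\mathrm{SO}(2,1)$) are considered. Such an isometry is elliptic if $\mathrm{tr}(g)<3$. Since $\psi$ has no fixed points, $\Gamma=\langle\psi\rangle$ acts freely and properly discontinuously on $\mathbb{E}$, and $\mathbb{E}/\Gamma$ is a flat Lorentz manifold. A timelike curve in $\mathbb{E}/\Gamma$ is a $C^1$ path $c:[0,1]\to \mathbb{E}/\Gamma$ all of whose tangent vectors are timelike; it is closed if $c(0)=c(1)$. The CTC region of $\mathbb{E}/\Gamma$ is the set of points lying on some closed timelike curve. $\mathcal{T}(\Gamma)$ is the set of $p\in\mathbb{E}$ whose image $[p]$ lies in the CTC region of $\mathbb{E}/\Gamma$. *)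

(* Defs.v *)
From HB Require Import structures.
From mathcomp Require Import all_boot all_order all_algebra.
From mathcomp Require Import generic_quotient.
From mathcomp Require Import all_classical all_reals all_analysis.
From mathcomp Require Import ring.

Set Implicit Arguments.
Unset Strict Implicit.
Unset Printing Implicit Defensive.

Import Order.TTheory GRing.Theory Num.Theory.
Import numFieldNormedType.Exports.

Local Open Scope classical_set_scope.
Local Open Scope ring_scope.
Local Open Scope quotient_scope.

(* An origin is fixed, so the same type serves for the affine space E and for
   its vector space of translations R^{2,1}. *)
Notation Minkowski R := 'cV[R]_3.

Section Lorentz.
Variable R : realType.
Local Notation E := (Minkowski R).

Definition lorentz (u v : E) : R :=
  u 0 0 * v 0 0 + u 1 0 * v 1 0 - u 2%:R 0 * v 2%:R 0.

Definition timelike (v : E) : Prop := lorentz v v < 0.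

Definition O21 : set 'M[R]_3 :=
  [set g | forall u v, lorentz (g *m u) (g *m v) = lorentz u v].

Definition SO21 : set 'M[R]_3 := [set g | O21 g /\ \det g = 1].

Definition SO21_0 : set 'M[R]_3 := connected_component SO21 1%:M.

Definition gram : 'M[R]_3 :=
  \matrix_(i, j) if i == j then (if i == 2%:R then -1 else 1) else 0.

Lemma lorentzE u v : lorentz u v = (u^T *m gram *m v) 0 0.
Proof.
rewrite /lorentz !mxE !big_ord_recl !big_ord0 !mxE.
rewrite !big_ord_recl !big_ord0 !mxE /=.
have -> : lift ord0 (lift ord0 ord0) = 2%:R :> 'I_3 by exact: val_inj.
have -> : lift ord0 ord0 = 1 :> 'I_3 by exact: val_inj.
by ring.
Qed.

Lemma O21_unit g : O21 g -> g \in unitmx.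
Proof.
move=> gO.
have gramE : g^T *m gram *m g = gram.
  apply/matrixP => i j.
  have entry (M : 'M[R]_3) :
      ((delta_mx i 0 : E)^T *m M *m (delta_mx j 0 : E)) 0 0 = M i j.
    by rewrite trmx_delta -rowE -colE !mxE.
  rewrite -[LHS]entry -[RHS]entry -lorentzE -gO lorentzE.
  by rewrite trmx_mul !mulmxA.
have gram2 : gram *m gram = 1%:M.
  apply/matrixP => i j; rewrite !mxE (bigD1 i) //= big1 ?addr0 => [|k ki].
    by rewrite !mxE eqxx; case: (i == j); case: (_ == _);
      rewrite ?mulr0 ?mulrNN ?mulr1.
  by rewrite !mxE eq_sym (negbTE ki) mul0r.
have gV : (gram *m g^T *m gram) *m g = 1%:M by rewrite -gram2 -{4}gramE !mulmxA.
by have [] := mulmx1_unit gV.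
Qed.

End Lorentz.

Arguments SO21_0 {R}.

Section Isometries.
Variable R : realType.
Local Notation E := (Minkowski R).

Record mink_isom : Type := MinkIsom {
  linear_part : 'M[R]_3;
  translation_part : E;
  linP : O21 linear_part }.

Definition isom_fun (f : mink_isom) (p : E) : E :=
  linear_part f *m p + translation_part f.

Lemma isom_eq (f g : mink_isom) :
  linear_part f = linear_part g -> translation_part f = translation_part g -> f = g.
Proof.
case: f g => [a v aP] [b w bP] /= ab vw; subst b w.
by rewrite (Prop_irrelevance aP bP).
Qed.

HB.instance Definition _ := gen_eqMixin mink_isom.
HB.instance Definition _ := gen_choiceMixin mink_isom.

Program Definition isom_one : mink_isom := @MinkIsom 1%:M 0 _.
Next Obligation. by move=> u v; rewrite !mul1mx. Qed.

Program Definition isom_mul (f g : mink_isom) : mink_isom :=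
  @MinkIsom (linear_part f *m linear_part g) (isom_fun f (translation_part g)) _.
Next Obligation. by move=> f g u v; rewrite -!mulmxA !linP. Qed.

Program Definition isom_inv (f : mink_isom) : mink_isom :=
  @MinkIsom (invmx (linear_part f)) (- (invmx (linear_part f) *m translation_part f)) _.
Next Obligation.
move=> f u v; have fu := O21_unit (linP f).
by rewrite -(linP f) !mulmxA mulmxV // !mul1mx.
Qed.

Fact isom_mulA : associative isom_mul.
Proof.
move=> f g h; apply: isom_eq => /=; first by rewrite mulmxA.
by rewrite /isom_fun /= mulmxDr mulmxA addrA.
Qed.

Fact isom_mul1 : left_id isom_one isom_mul.
Proof.
by move=> f; apply: isom_eq; rewrite /isom_mul /isom_fun /= mul1mx ?addr0.
Qed.

Fact isom_1mul : right_id isom_one isom_mul.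
Proof.
move=> f; apply: isom_eq; rewrite /isom_mul /isom_fun /= ?mulmx1 //.
by rewrite mulmx0 add0r.
Qed.

Fact isom_mulV : left_inverse isom_one isom_inv isom_mul.
Proof.
move=> f; have fu := O21_unit (linP f); apply: isom_eq => /=.
  by rewrite mulVmx.
by rewrite /isom_fun /= subrr.
Qed.

Fact isom_Vmul : right_inverse isom_one isom_inv isom_mul.
Proof.
move=> f; have fu := O21_unit (linP f); apply: isom_eq => /=.
  by rewrite mulmxV.
by rewrite /isom_fun /= mulmxN mulmxA mulmxV // mul1mx addNr.
Qed.

HB.instance Definition _ := isGroup.Build mink_isom
  isom_mulA isom_mul1 isom_1mul isom_mulV isom_Vmul.

Lemma isom_fun1 p : isom_fun 1%g p = p.
Proof. by rewrite /isom_fun /= mul1mx addr0. Qed.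

Lemma isom_funM (f g : mink_isom) p :
  isom_fun (f * g)%g p = isom_fun f (isom_fun g p).
Proof. by rewrite /isom_fun /= mulmxDr mulmxA addrA. Qed.

Definition elliptic (f : mink_isom) : Prop := \tr (linear_part f) < 3%:R.

Definition fixed_point_free (f : mink_isom) : Prop := forall p, isom_fun f p <> p.

Definition cyclic_group (f : mink_isom) : {pred mink_isom} :=
  fun g => `[< exists n : nat, g = (f ^+ n)%g \/ g = (f ^- n)%g >].

Fact cyclic_group1 (f : mink_isom) : 1%g \in cyclic_group f.
Proof. by apply/asboolP; exists 0%N; left; rewrite expg0. Qed.

Fact cyclic_group_inv (f : mink_isom) : invg_closed (cyclic_group f).
Proof.
move=> g /asboolP[n gE]; apply/asboolP; exists n.
by case: gE => ->; [right | left; rewrite invgK].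
Qed.

Fact cyclic_group_mul (f : mink_isom) : mulg_closed (cyclic_group f).
Proof.
have mix m n : exists k : nat, ((f ^+ m) * (f ^- n) = f ^+ k)%g \/
                         ((f ^+ m) * (f ^- n) = f ^- k)%g.
  have [nm|/ltnW mn] := leqP n m.
    by exists (m - n)%N; left; rewrite -{1}(subnK nm) expgnDr mulgK.
  exists (n - m)%N; right.
  by rewrite -{1}(subnK mn) expgnDr invgM mulVKg.
move=> g h /asboolP[m [->|->]] /asboolP[n [->|->]]; apply/asboolP.
- by exists (m + n)%N; left; rewrite expgnDr.
- exact: mix.
- have [k kE] := mix n m; exists k.
  suff -> : (f ^- m * f ^+ n = f ^+ n * f ^- m)%g by exact: kE.
  by apply/commute_sym/commuteV/commuteX2.
- by exists (n + m)%N; right; rewrite expgnDr invgM.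
Qed.

HB.instance Definition _ (f : mink_isom) :=
  isMulClosed.Build mink_isom (cyclic_group f) (@cyclic_group_mul f).
HB.instance Definition _ (f : mink_isom) :=
  isMul1Closed.Build mink_isom (cyclic_group f) (cyclic_group1 f).
HB.instance Definition _ (f : mink_isom) :=
  isInvClosed.Build mink_isom (cyclic_group f) (@cyclic_group_inv f).

End Isometries.

Section Quotient.
Variables (R : realType) (Gamma : groupClosed (mink_isom R)).
Local Notation E := (Minkowski R).

Definition same_orbit (p q : E) : bool :=
  `[< exists2 g : mink_isom R, g \in Gamma & q = isom_fun g p >].

Fact same_orbit_refl : reflexive same_orbit.
Proof. by move=> p; apply/asboolP; exists 1%g; rewrite ?gpred1 ?isom_fun1. Qed.

Fact same_orbit_sym : symmetric same_orbit.
Proof.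
suff imp p q : same_orbit p q -> same_orbit q p.
  by move=> p q; apply/idP/idP; apply: imp.
move=> /asboolP[g gG ->]; apply/asboolP; exists g^-1%g; rewrite ?gpredV //.
by rewrite -isom_funM mulVg isom_fun1.
Qed.

Fact same_orbit_trans : transitive same_orbit.
Proof.
move=> q p r /asboolP[g gG ->] /asboolP[h hG ->]; apply/asboolP.
by exists (h * g)%g; rewrite ?gpredM ?isom_funM.
Qed.

Canonical same_orbit_equiv :=
  EquivRel same_orbit same_orbit_refl same_orbit_sym same_orbit_trans.

Definition orbit_space : Type := quotient_topology {eq_quot same_orbit_equiv}.
HB.instance Definition _ := Topological.on orbit_space.
HB.instance Definition _ := Quotient.on orbit_space.

Definition orbit_proj (p : E) : orbit_space := \pi_orbit_space p.

Definition I01 : set R := `[0, 1]%classic.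

(* The flat Lorentz structure of E / Gamma is the one for which [orbit_proj] is a
   local isometry: a chart is an inverse [phi] of [orbit_proj] on the image of an
   open set [U] (so [orbit_proj] is injective on [U]), with values in E; outside
   [orbit_proj @` U] the values of [phi] are irrelevant. *)
Definition is_chart (U : set E) (phi : orbit_space -> E) : Prop :=
  open U /\ forall p, U p -> phi (orbit_proj p) = p.

(* Derivative along [0, 1], hence one-sided at 0 and 1. *)
Definition has_velocity (s : R -> E) (t : R) (w : E) : Prop :=
  (r - t)^-1 *: (s r - s t) @[r --> within I01 t^'] --> w.

(* Only the restriction of [c] to [0, 1] matters. *)
Definition C1_path (c : R -> orbit_space) : Prop :=
  {within I01, continuous c} /\
  forall t, I01 t -> exists U phi, [/\ is_chart U phi, (orbit_proj @` U) (c t) &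
    exists w : R -> E, \forall r \near t, I01 r ->
      has_velocity (phi \o c) r (w r) /\ w x @[x --> within I01 (nbhs r)] --> w r].

(* [w] is a tangent vector of [c] at time [t], read in some chart; another chart
   changes [w] by the linear part of an element of Gamma, so its causal type is
   well defined. *)
Definition tangent_vector (c : R -> orbit_space) (t : R) (w : E) : Prop :=
  exists U phi, [/\ is_chart U phi, (orbit_proj @` U) (c t) &
    has_velocity (phi \o c) t w].

Definition timelike_curve (c : R -> orbit_space) : Prop :=
  C1_path c /\ forall t w, I01 t -> tangent_vector c t w -> timelike w.

Definition CTC_region : set orbit_space :=
  [set x | exists c, [/\ timelike_curve c, c 0 = c 1 &
                         exists2 t, I01 t & c t = x]].

Definition CTC_preimage : set E := [set p | CTC_region (orbit_proj p)].

End Quotient.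

Arguments orbit_proj {R} Gamma p.
Arguments CTC_region {R} Gamma.
Arguments CTC_preimage {R} Gamma.

(* Main.v *)
(* The linear part g of psi is a rotation about a timelike axis, so freeness
   forces psi to be a screw motion with a nonzero timelike translation b along
   that axis. Then psi^n p - p is n b plus a vector orthogonal to b that stays
   bounded in n, hence timelike for large n, and the segment from p to psi^n p
   projects to a closed timelike curve through [p]. *)

Require Import Defs.
From HB Require Import structures.
From mathcomp Require Import all_boot all_order all_algebra.
From mathcomp Require Import all_classical all_reals all_analysis.
From mathcomp Require Import ring lra.

Set Implicit Arguments.
Unset Strict Implicit.
Unset Printing Implicit Defensive.

Import Order.TTheory GRing.Theory Num.Theory.
Import numFieldNormedType.Exports.

Local Open Scope classical_set_scope.
Local Open Scope ring_scope.

(** * Matrix identities in O(2,1) and the axis of a linear isometry *)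

Section Axis.
Context {R : realType}.
Implicit Types (g M : 'M[R]_3) (u v w a : Minkowski R) (x y z : R).

Lemma ord3P (P : 'I_3 -> Prop) : P 0 -> P 1 -> P 2%:R -> forall i, P i.
Proof.
by move=> P0 P1 P2 [[|[|[|//]]] i3]; [move: P0 | move: P1 | move: P2];
  congr P; exact: val_inj.
Qed.

Lemma sum3 (F : 'I_3 -> R) : \sum_i F i = F 0 + F 1 + F 2%:R.
Proof.
rewrite !big_ord_recl big_ord0 addr0 addrA.
by congr (_ + F _ + F _); exact: val_inj.
Qed.

Lemma lift3E :
  ((lift 0 0 = 1 :> 'I_3) * (lift 0 1 = 2%:R :> 'I_3) * (lift 1 0 = 0 :> 'I_3) *
  (lift 1 1 = 2%:R :> 'I_3) * (lift 2%:R 0 = 0 :> 'I_3) * (lift 2%:R 1 = 1 :> 'I_3))%type.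
Proof. by do !split; exact: val_inj. Qed.

Lemma det2 (M : 'M[R]_2) : \det M = M 0 0 * M 1 1 - M 0 1 * M 1 0.
Proof.
rewrite (expand_det_row _ 0) !big_ord_recl big_ord0 /cofactor !det_mx11 !mxE /=.
have -> : lift ord0 ord0 = 1 :> 'I_2 by exact: val_inj.
have -> : lift 1 0 = 0 :> 'I_2 by exact: val_inj.
have -> : ord0 = 0 :> 'I_2 by [].
by rewrite /= expr0 expr1; ring.
Qed.

Lemma gram_mulE g i j :
  (gram R *m g^T *m gram R) i j = gram R i i * g j i * gram R j j.
Proof.
by move: i j; apply: ord3P; apply: ord3P; rewrite !(mxE, sum3) /=; ring.
Qed.

Lemma gram_mulr_gram : gram R *m gram R = 1%:M.
Proof. by apply/matrixP; apply: ord3P; apply: ord3P; rewrite !(mxE, sum3) /=; ring. Qed.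

Lemma O21_gram g : O21 g -> g^T *m gram R *m g = gram R.
Proof.
move=> gO; apply/matrixP => i j.
have entry M : ((delta_mx i 0 : 'cV[R]_3)^T *m M *m (delta_mx j 0 : 'cV[R]_3)) 0 0 = M i j.
  by rewrite trmx_delta -rowE -colE !mxE.
by rewrite -[LHS]entry -[RHS]entry -lorentzE -gO lorentzE trmx_mul !mulmxA.
Qed.

Lemma O21_mulVmx g : O21 g -> (gram R *m g^T *m gram R) *m g = 1%:M.
Proof. by move=> gO; rewrite -gram_mulr_gram -{4}(O21_gram gO) !mulmxA. Qed.

Lemma O21_invmx g : O21 g -> invmx g = gram R *m g^T *m gram R.
Proof.
move=> gO; rewrite -[RHS]mulmx1 -(mulmxV (O21_unit gO)) mulmxA O21_mulVmx//.
by rewrite mul1mx.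
Qed.

(** With determinant 1 the adjugate is the inverse, and the inverse is the transpose conjugated by
    [gram]; so every 2x2 minor is an entry of [g] up to sign. *)
Lemma SO21_adj g i j : SO21 g -> cofactor g j i = gram R i i * g j i * gram R j j.
Proof.
move=> [gO gdet]; rewrite -gram_mulE -O21_invmx//.
by rewrite /invmx O21_unit// gdet invr1 scale1r mxE.
Qed.

Lemma SO21_cofactors g : SO21 g ->
  [/\ [/\ g 1 1 * g 2%:R 2%:R - g 1 2%:R * g 2%:R 1 = g 0 0,
      g 1 0 * g 2%:R 2%:R - g 1 2%:R * g 2%:R 0 = - g 0 1 &
      g 1 0 * g 2%:R 1 - g 1 1 * g 2%:R 0 = - g 0 2%:R],
   [/\ g 0 1 * g 2%:R 2%:R - g 0 2%:R * g 2%:R 1 = - g 1 0,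
      g 0 0 * g 2%:R 2%:R - g 0 2%:R * g 2%:R 0 = g 1 1 &
      g 0 0 * g 2%:R 1 - g 0 1 * g 2%:R 0 = g 1 2%:R] &
   [/\ g 0 1 * g 1 2%:R - g 0 2%:R * g 1 1 = - g 2%:R 0,
      g 0 0 * g 1 2%:R - g 0 2%:R * g 1 0 = g 2%:R 1 &
      g 0 0 * g 1 1 - g 0 1 * g 1 0 = g 2%:R 2%:R]].
Proof.
move=> gS.
by split; split;
  [have := SO21_adj 0 0 gS | have := SO21_adj 1 0 gS | have := SO21_adj 2%:R 0 gS
  |have := SO21_adj 0 1 gS | have := SO21_adj 1 1 gS | have := SO21_adj 2%:R 1 gS
  |have := SO21_adj 0 2%:R gS | have := SO21_adj 1 2%:R gS
  |have := SO21_adj 2%:R 2%:R gS];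
  rewrite /cofactor det2 !mxE !lift3E /= => h; lra.
Qed.

Lemma O21_cols g : O21 g -> forall i j,
  g 0 i * g 0 j + g 1 i * g 1 j - g 2%:R i * g 2%:R j = gram R i j.
Proof.
move=> gO i j; rewrite -(O21_gram gO).
by rewrite !(mxE, sum3) /=; ring.
Qed.

Lemma O21_rows g : O21 g -> forall i j,
  g i 0 * g j 0 + g i 1 * g j 1 - g i 2%:R * g j 2%:R = gram R i j.
Proof.
move=> gO i j; have := mulmx1C (O21_mulVmx gO).
rewrite -!mulmxA => /(congr1 (mulmx^~ (gram R))).
rewrite -!mulmxA gram_mulr_gram mulmx1 mul1mx => <-.
by rewrite !(mxE, sum3) /=; ring.
Qed.

(* By Cayley-Hamilton this is g^2 - (tr g - 1) g + 1, i.e. the characteristic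
   polynomial divided by X - 1: it is 3 - tr g times the projection onto the
   axis of g, and its last column spans the axis. *)
Definition axis_mx g : 'M[R]_3 := g + invmx g + (1 - \tr g)%:M.

Lemma axis_mxE g i j : O21 g ->
  axis_mx g i j = g i j + gram R i i * g j i * gram R j j +
    (1 - g 0 0 - g 1 1 - g 2%:R 2%:R) *+ (i == j).
Proof.
move=> gO; rewrite /axis_mx O21_invmx// 2!mxE gram_mulE [_%:M _ _]mxE /mxtrace sum3.
by congr (_ + _ *+ _); rewrite !opprD !addrA.
Qed.

Lemma axis_mx_fixed g : SO21 g -> g *m axis_mx g = axis_mx g.
Proof.
move=> gS; have gO := gS.1.
have [[c00 c01 c02] [c10 c11 c12] [c20 c21 c22]] := SO21_cofactors gS.
have rows i j := O21_rows gO i j.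
(* Both sides are at most quadratic in the entries of [g], so each goal is a linear combination of
   the cofactor and row relations, with monomials as unknowns. *)
apply/matrixP; apply: ord3P; apply: ord3P; rewrite mxE sum3 !axis_mxE// !mxE /=;
  have := rows 0 0; have := rows 1 1; have := rows 2%:R 2%:R;
  have := rows 0 1; have := rows 0 2%:R; have := rows 1 2%:R;
  rewrite !mxE /=; lra.
Qed.

Lemma axis_mx_rank1 g i j : SO21 g ->
  axis_mx g i j * axis_mx g 2%:R 2%:R = axis_mx g i 2%:R * axis_mx g 2%:R j.
Proof.
move=> gS; have gO := gS.1.
have [[c00 c01 c02] [c10 c11 c12] [c20 c21 c22]] := SO21_cofactors gS.
have rows := O21_rows gO; have cols := O21_cols gO.
move: i j; apply: ord3P; apply: ord3P; rewrite !axis_mxE// !mxE /=;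
  have := rows 0 0; have := rows 1 1; have := rows 2%:R 2%:R;
  have := rows 0 1; have := rows 0 2%:R; have := rows 1 2%:R;
  have := cols 0 0; have := cols 1 1; have := cols 2%:R 2%:R;
  have := cols 0 1; have := cols 0 2%:R; have := cols 1 2%:R;
  rewrite !mxE /=; lra.
Qed.

(** Divided by [3%:R - \tr g], this splits any vector into a part along the axis and a part in the
    range of [1%:M - g]. *)
Lemma axis_mx_decomp g : O21 g ->
  axis_mx g = (3%:R - \tr g)%:M - (1%:M - g) *m (1%:M - invmx g).
Proof.
move=> gO; rewrite /axis_mx mulmxBl mul1mx mulmxBr mulmx1 mulmxV ?O21_unit//.
have -> : 3%:R - \tr g = 1 + 1 + (1 - \tr g) by ring.
by rewrite !raddfD /=; apply/matrixP => i j; rewrite !mxE; ring.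
Qed.

Lemma mulmx_rank1 M k v : (forall i j, M i j * M k k = M i k * M k j) ->
  M k k != 0 -> M *m v = ((M *m v) k 0 / M k k) *: col k M.
Proof.
move=> M1 Mkk; apply/matrixP => i j; rewrite ord1 !mxE.
apply: (mulIf Mkk); rewrite mulrAC divfK// !mulr_suml.
by apply: eq_bigr => l _; rewrite mulrAC M1; ring.
Qed.

(** * The Lorentz form, time-orientation and timelike screw motions *)

Lemma lorentzC u v : lorentz u v = lorentz v u.
Proof. by rewrite /lorentz; ring. Qed.

Lemma lorentzDr u v w : lorentz u (v + w) = lorentz u v + lorentz u w.
Proof. by rewrite /lorentz !mxE; ring. Qed.

Lemma lorentzZr x u v : lorentz u (x *: v) = x * lorentz u v.
Proof. by rewrite /lorentz !mxE; ring. Qed.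

Lemma lorentzBr u v w : lorentz u (v - w) = lorentz u v - lorentz u w.
Proof. by rewrite /lorentz !mxE; ring. Qed.

(** Write P for [axis_mx g]. For i = 0, 1 one has P_2i = - P_i2, so the rank-one relation reads P_ii
    P_22 = - P_i2^2. The form on the last column is thus - (tr P) P_22, and tr P = 3 - tr g. *)
Lemma lorentz_axis g : SO21 g ->
  lorentz (col 2%:R (axis_mx g)) (col 2%:R (axis_mx g)) =
    - (3%:R - \tr g) * axis_mx g 2%:R 2%:R.
Proof.
move=> gS; have gO := gS.1.
have colE k M : lorentz (col k M) (col k M) =
  M 0 k * M 0 k + M 1 k * M 1 k - M 2%:R k * M 2%:R k by rewrite /lorentz !mxE.
rewrite colE /mxtrace sum3.
have := axis_mx_rank1 0 0 gS; have := axis_mx_rank1 1 1 gS.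
by rewrite !axis_mxE// !mxE /=; lra.
Qed.

Lemma O21_22_sqr g : O21 g -> 1 <= g 2%:R 2%:R ^+ 2.
Proof.
move=> gO; have := O21_rows gO 2%:R 2%:R; rewrite mxE /= => h.
have := sqr_ge0 (g 2%:R 0); have := sqr_ge0 (g 2%:R 1); rewrite !expr2; lra.
Qed.

(* The entry g_22 cannot cross 0, its square being at least 1. *)
Lemma SO21_0_22_ge1 g : SO21_0 g -> 1 <= g 2%:R 2%:R.
Proof.
move=> g0.
have SO1 : SO21 (1%:M : 'M[R]_3) by split; [move=> u v; rewrite !mul1mx | exact: det1].
set f := fun M : 'M[R]_3 => M 2%:R 2%:R.
have : connected (f @` SO21_0).
  apply: connected_continuous_connected; first exact: component_connected.
  by apply: continuous_subspaceT; exact: coord_continuous.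
move=> /connected_intervalP fI.
have sq M : SO21_0 M -> 1 <= f M ^+ 2.
  by move=> /connected_component_sub[MO _]; exact: O21_22_sqr.
rewrite leNgt; apply/negP => lt1.
have g22 := sq _ g0; rewrite -/(f g) in lt1.
have [M /sq + M0] : (f @` SO21_0) 0.
  apply: (fI (f g) (f 1%:M)); first by exists g.
    by exists 1%:M => //; exact: connected_component_refl.
  (* A value of [f g] strictly between 0 and 1 would have square below 1, so [f g] is at most 0. *)
  rewrite {2}/f mxE eqxx ler01 andbT leNgt; apply/negP => gt0.
  by move: g22; rewrite leNgt expr2 -(mulr1 1) ltr_pM// ltW.
by rewrite M0 expr0n /= ler10.
Qed.

(** Orthogonality gives c z = a x + b y. By Lagrange's identity, c^2 times the form on [w] is then -
    B(u,u) (x^2 + y^2) + (a y - b x)^2. *)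
Lemma timelike_perp_ge0 u w : timelike u -> lorentz u w = 0 -> 0 <= lorentz w w.
Proof.
rewrite /timelike /lorentz; set a := u 0 0; set b := u 1 0; set c := u 2%:R 0.
set x := w 0 0; set y := w 1 0; set z := w 2%:R 0 => uT uw.
have c2 : 0 < c ^+ 2 by have := sqr_ge0 a; have := sqr_ge0 b; rewrite !expr2; lra.
have cz : (c * z) ^+ 2 = (a * x + b * y) ^+ 2 by congr (_ ^+ 2); lra.
rewrite -(pmulr_rge0 _ c2).
have xy : 0 <= x ^+ 2 + y ^+ 2 by rewrite addr_ge0 ?sqr_ge0.
have -> : c ^+ 2 * (x * x + y * y - z * z) =
    (c * c - a * a - b * b) * (x ^+ 2 + y ^+ 2) + (a * y - b * x) ^+ 2 +
    ((a * x + b * y) ^+ 2 - (c * z) ^+ 2) by ring.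
by rewrite cz subrr addr0 addr_ge0 ?sqr_ge0// mulr_ge0//; lra.
Qed.

(** The decomposition of [axis_mx g] writes the translation part as [mu *: a + (q - g *m q)]. Taking
    [q] as origin absorbs the second term; [mu] is nonzero, since otherwise [q] would be fixed. *)
Lemma elliptic_screw (psi : mink_isom R) :
  SO21_0 (linear_part psi) -> elliptic psi -> fixed_point_free psi ->
  exists b q, [/\ timelike b, linear_part psi *m b = b &
    forall p, isom_fun psi p = linear_part psi *m (p - q) + q + b].
Proof.
rewrite /elliptic; set g := linear_part psi; set v := translation_part psi.
move=> g0 gell free; have gS := connected_component_sub g0; have gO := gS.1.
have t3 : 3%:R - \tr g != 0 by rewrite gt_eqF// subr_gt0.
(* This entry is 2 g_22 + 1 - tr g, with g_22 >= 1 and tr g < 3. *)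
have P22 : 0 < axis_mx g 2%:R 2%:R.
  have := SO21_0_22_ge1 g0; move: gell.
  by rewrite axis_mxE// /mxtrace sum3 !mxE /=; lra.
set a := col 2%:R (axis_mx g).
have aT : timelike a.
  by rewrite /timelike lorentz_axis// mulNr oppr_lt0 mulr_gt0// subr_gt0.
have ga : g *m a = a by rewrite /a colE mulmxA axis_mx_fixed.
set q := (3%:R - \tr g)^-1 *: ((1%:M - invmx g) *m v).
set mu := (3%:R - \tr g)^-1 * ((axis_mx g *m v) 2%:R 0 / axis_mx g 2%:R 2%:R).
have vE : v = mu *: a + q - g *m q.
  have : axis_mx g *m v = ((axis_mx g *m v) 2%:R 0 / axis_mx g 2%:R 2%:R) *: a.
    by apply: mulmx_rank1; [move=> i j; exact: axis_mx_rank1 | rewrite gt_eqF].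
  rewrite {1}axis_mx_decomp// mulmxBl mul_scalar_mx => vE.
  apply: (scalerI t3); rewrite -[LHS](subrK (((1%:M - g) *m (1%:M - invmx g)) *m v)) vE.
  rewrite scalerBr scalerDr -scalemxAr !scalerA divff// mulrA divff// !mul1r.
  rewrite !scale1r -addrA -mulmxA; set z := ((1%:M - _) *m v).
  by rewrite mulmxBl mul1mx.
have psiE p : isom_fun psi p = g *m (p - q) + q + mu *: a.
  by rewrite /isom_fun -/g -/v vE mulmxBr; apply/matrixP => i j; rewrite !mxE; ring.
have mu0 : mu != 0.
  apply/eqP => mu0; apply: (free q).
  by rewrite psiE mu0 subrr mulmx0 add0r scale0r addr0.
exists (mu *: a), q; split => //; last by rewrite -scalemxAr ga.
rewrite /timelike lorentzZr lorentzC lorentzZr mulrA -expr2 pmulr_rlt0//.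
by rewrite lt_neqAle sqr_ge0 eq_sym expf_neq0.
Qed.

(* Each power of the screw motion displaces [p] by an amount that is bounded
   transversally to the axis and grows linearly along it. *)
Lemma screw_displacement (psi : mink_isom R) b q :
  timelike b -> linear_part psi *m b = b ->
  (forall p, isom_fun psi p = linear_part psi *m (p - q) + q + b) ->
  forall p, exists n, timelike (isom_fun (psi ^+ n)%g p - p).
Proof.
set g := linear_part psi => bT gb psiE p.
have b0 : lorentz b b != 0 by rewrite lt_eqF.
(* The component of [p - q] orthogonal to [b]; the vector [w] below is its image under the n-th
   power of the linear part. *)
pose u := p - q - (lorentz b (p - q) / lorentz b b) *: b.
have bu : lorentz b u = 0 by rewrite lorentzBr lorentzZr divfK// subrr.
have pow n : exists w, [/\ isom_fun (psi ^+ n)%g p = p - u + w + n%:R *: b,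
    lorentz b w = 0 & lorentz w w = lorentz u u].
  elim: n => [|n [w [pw bw ww]]].
    by exists u; split; rewrite // expg0 isom_fun1 subrK scale0r addr0.
  exists (g *m w); split; last by rewrite linP.
    rewrite expgS isom_funM pw psiE.
    have -> : p - u + w + n%:R *: b - q =
        w + (n%:R + lorentz b (p - q) / lorentz b b) *: b.
      by apply/matrixP => i j; rewrite !mxE; ring.
    rewrite mulmxDr -scalemxAr gb -natr1.
    by apply/matrixP => i j; rewrite !mxE; ring.
  by rewrite -{1}gb linP.
have uu : 0 <= lorentz u u by exact: (timelike_perp_ge0 bT).
have := archi_boundP (divr_ge0 (mulr_ge0 (ler0n R 4) uu) (ltW (_ : 0 < - lorentz b b))).
rewrite oppr_gt0 => /(_ bT); set n := Num.bound _ => nb.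
exists n; have [w [-> bw ww]] := pow n; rewrite /timelike.
have -> : p - u + w + n%:R *: b - p = w - u + n%:R *: b.
  by apply/matrixP => i j; rewrite !mxE; ring.
(* By the parallelogram law this bounds the form on [w - u] by [4%:R * lorentz u u], uniformly in
   [n]. *)
have wu : 0 <= lorentz (w + u) (w + u).
  by apply: (timelike_perp_ge0 bT); rewrite lorentzDr bw bu addr0.
have -> : lorentz (w - u + n%:R *: b) (w - u + n%:R *: b) =
    4%:R * lorentz u u - lorentz (w + u) (w + u) + n%:R ^+ 2 * lorentz b b.
  have -> : 4%:R * lorentz u u = 2%:R * lorentz w w + 2%:R * lorentz u u.
    by rewrite ww; ring.
  rewrite (_ : _ + _ * lorentz b b =
    2%:R * lorentz w w + 2%:R * lorentz u u - lorentz (w + u) (w + u) +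
    n%:R ^+ 2 * lorentz b b + 2%:R * n%:R * (lorentz b w - lorentz b u)).
    by rewrite /lorentz !mxE; ring.
  by rewrite bw bu; ring.
move: nb; rewrite ltr_pdivrMr ?oppr_gt0// => nb.
(* [n] was chosen with 4 B(u,u) < - n B(b,b); comparing n with n^2 passes to the quadratic term. *)
have sqn (m : nat) : m%:R <= m%:R ^+ 2 :> R.
  by rewrite -natrX ler_nat -mulnn; case: m => // m; rewrite leq_pmulr.
have : n%:R ^+ 2 * lorentz b b <= n%:R * lorentz b b by rewrite ler_nM2r.
lra.
Qed.

End Axis.

(** * Charts of the orbit space and projected segments *)

Section Segment.
Context {R : realType} (Gamma : groupClosed (mink_isom R)).
Implicit Types (p q d : Minkowski R) (t : R).

Lemma orbit_projP p q :
  orbit_proj Gamma p = orbit_proj Gamma q <->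
  exists2 h, h \in Gamma & q = isom_fun h p.
Proof.
split; first by move=> /eqquotP/asboolP.
by move=> hpq; apply/eqquotP/asboolP.
Qed.

Lemma orbit_proj_continuous : continuous (orbit_proj Gamma).
Proof. exact: pi_continuous. Qed.

Lemma orbit_proj_surj (x : orbit_space Gamma) : exists p, orbit_proj Gamma p = x.
Proof. by exists (repr x); exact: reprK. Qed.

Lemma chart_exists (U : set (Minkowski R)) : open U ->
  {in U &, injective (orbit_proj Gamma)} ->
  exists phi, is_chart (Gamma := Gamma) U phi.
Proof.
move=> Uo Uinj.
(* The default 0 is taken only off the image of [U]. *)
exists (fun x => xget 0 [set p | U p /\ orbit_proj Gamma p = x]); split => // p Up.
have [Uq qp] : [set q | U q /\ orbit_proj Gamma q = orbit_proj Gamma p]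
    (xget 0 [set q | U q /\ orbit_proj Gamma q = orbit_proj Gamma p]).
  by apply: (@xgetI _ 0 _ p).
by apply: Uinj; rewrite ?inE.
Qed.

(** Needed for velocities to be unique limits, also at the endpoints. *)
Lemma within_I01_proper t : I01 t -> ProperFilter (within (@I01 R) t^').
Proof.
rewrite /I01 /= in_itv /= => /andP[t0 t1].
apply: Build_ProperFilter_ex => P /nbhs_ballP[e /= e0 eP].
(* A step of at most 1/2 stays in [0, 1], to the right from the first half and to the left from the
   second. *)
pose m := Num.min (e / 2) (1 / 2).
have [m0 me m1] : [/\ 0 < m, m < e & m <= 1 / 2].
  by rewrite /m lt_min gt_min ge_min lexx orbT; split=> //; [apply/andP; split| apply/orP; left]; lra.
have [th|th] := leP t (1 / 2); [exists (t + m) | exists (t - m)]; apply: eP.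
- by rewrite /ball /= opprD addrA subrr sub0r normrN gtr0_norm.
- by rewrite -subr_eq0 addrAC subrr add0r gt_eqF.
- by rewrite in_itv /=; apply/andP; split; lra.
- by rewrite /ball /= opprB addrCA subrr addr0 gtr0_norm.
- by rewrite -subr_eq0 addrAC subrr add0r oppr_eq0 gt_eqF.
- by rewrite in_itv /=; apply/andP; split; lra.
Qed.

Lemma line_continuous p d : continuous (fun t : R => p + t *: d).
Proof. by move=> t; apply: cvgD; [exact: cvg_cst | apply: cvgZl; exact: cvg_id]. Qed.

Lemma line_velocity p d (s : R -> Minkowski R) t : I01 t ->
  (\forall r \near t, s r = p + r *: d) -> has_velocity s t d.
Proof.
move=> It st; rewrite /has_velocity.
have stt : s t = p + t *: d by exact: nbhs_singleton st.
have FF := within_I01_proper It.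
apply: cvg_near_cst; rewrite near_withinE near_withinE.
apply: filterS st => r sr rt _.
rewrite sr stt opprD addrACA subrr add0r -scalerBl scalerA mulVf ?scale1r//.
by rewrite subr_eq0.
Qed.

Section Projection.
Variables p d : Minkowski R.
Let line t := p + t *: d.
Let c t := orbit_proj Gamma (line t).

(* Reading the projected segment in a chart [phi] gives, near [t], its image
   under a fixed element of [Gamma]. *)
Lemma segment_chart U phi t : is_chart (Gamma := Gamma) U phi ->
  (orbit_proj Gamma @` U) (c t) -> exists2 h, h \in Gamma &
  \forall r \near t, phi (c r) = isom_fun h p + r *: (linear_part h *m d).
Proof.
move=> [Uo phiK] [u Uu /esym/orbit_projP[h hG uE]]; exists h => //.
have lineE r : isom_fun h (line r) = isom_fun h p + r *: (linear_part h *m d).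
  by rewrite /isom_fun mulmxDr -scalemxAr addrAC.
have cont : {for t, continuous (isom_fun h \o line)}.
  rewrite (_ : _ \o _ = fun r => isom_fun h p + r *: (linear_part h *m d)).
    exact: line_continuous.
  by apply/funext => r; exact: lineE.
have nearU : \forall r \near t, U (isom_fun h (line r)).
  by apply: cont; apply: open_nbhs_nbhs; split => //=; rewrite -uE.
apply: filterS nearU => r Ur; rewrite -lineE -[RHS]phiK//; congr phi.
by apply/orbit_projP; exists h.
Qed.

Lemma segment_timelike_curve :
  (forall x, exists U phi, is_chart (Gamma := Gamma) U phi /\ U x) ->
  timelike d -> timelike_curve (Gamma := Gamma) c.
Proof.
move=> charts dT; split; first split.
- apply: continuous_subspaceT => t.
  apply: continuous_comp; [exact: line_continuous | exact: orbit_proj_continuous].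
- move=> t It; have [U [phi [Uphi Ut]]] := charts (line t).
  have cU : (orbit_proj Gamma @` U) (c t) by exists (line t).
  exists U, phi; split => //.
  (* The velocity at [r] depends on a neighbourhood of [r], so the affine formula is needed near
     every [r] near [t]. *)
  have [h _ /near_join nearh] := segment_chart Uphi cU.
  exists (fun=> linear_part h *m d); apply: filterS nearh => r rh Ir.
  by split; [exact: line_velocity rh | exact: cvg_cst].
- move=> t w It [U [phi [Uphi cU wv]]].
  have [h _ nearh] := segment_chart Uphi cU.
  have hv := line_velocity It nearh.
  have FF := within_I01_proper It.
  have -> : w = linear_part h *m d by exact: (cvg_unique _ wv hv).
  by rewrite /timelike linP.
Qed.

End Projection.

Lemma timelike_translate_CTC p h :
  (forall x, exists U phi, is_chart (Gamma := Gamma) U phi /\ U x) ->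
  h \in Gamma -> timelike (isom_fun h p - p) -> CTC_preimage Gamma p.
Proof.
move=> charts hG hT; exists (fun t => orbit_proj Gamma (p + t *: (isom_fun h p - p))).
split; first exact: segment_timelike_curve.
  rewrite scale0r addr0 scale1r addrC subrK.
  by apply/orbit_projP; exists h.
by exists 0; rewrite /I01 /= ?in_itv /= ?lexx ?ler01// scale0r addr0.
Qed.

End Segment.

(** * Charts for the group generated by a screw motion *)

Lemma lorentz_continuous (R : realType) (b : Minkowski R) :
  continuous (lorentz b).
Proof.
move=> u; have cM k : (fun w : Minkowski R => b k 0 * w k 0) @ u --> b k 0 * u k 0.
  exact: (cvgM (cvg_cst (b k 0)) (@coord_continuous R 3 1 k 0 u)).
exact: (cvgB (cvgD (cM 0) (cM 1)) (cM 2%:R)).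
Qed.

(** The linear part preserves the form and fixes [b], hence preserves [lorentz b]; each application
    of [psi] then adds only the contribution of the translation [b]. *)
Lemma screw_power_axis (R : realType) (psi : mink_isom R) b q :
  linear_part psi *m b = b ->
  (forall p, isom_fun psi p = linear_part psi *m (p - q) + q + b) ->
  forall n p,
    lorentz b (isom_fun (psi ^+ n)%g p) = lorentz b p + n%:R * lorentz b b.
Proof.
move=> psib psiE; elim=> [|n IHn] p; first by rewrite expg0 isom_fun1 mul0r addr0.
rewrite expgS isom_funM psiE !lorentzDr -[X in lorentz X (_ *m _)]psib linP.
by rewrite lorentzBr IHn -natr1; ring.
Qed.

(** A positive power of [psi] shifts [lorentz b] by at least - B(b,b) in absolute value, while two
    points of the slab differ by strictly less; so the projection is injective there. *)
Lemma screw_charts (R : realType) (psi : mink_isom R) b q :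
  timelike b -> linear_part psi *m b = b ->
  (forall p, isom_fun psi p = linear_part psi *m (p - q) + q + b) ->
  forall x, exists U phi, is_chart (Gamma := cyclic_group psi) U phi /\ U x.
Proof.
move=> bT psib psiE x.
have pow := screw_power_axis psib psiE.
(* A slab around [x], orthogonal to the axis and thinner than the translation length. *)
pose U := [set u : Minkowski R | `|lorentz b u - lorentz b x| < - lorentz b b / 2].
have Uo : open U.
  have fc : continuous (fun u : Minkowski R => `|lorentz b u - lorentz b x|).
    move=> u.
    exact: (cvg_norm (cvgB (@lorentz_continuous R b u) (cvg_cst (lorentz b x)))).
  exact: (open_comp (fun u _ => fc u) (@open_lt _ (- lorentz b b / 2))).
have near_eq u w (n : nat) : U u -> U w -> w = isom_fun (psi ^+ n)%g u -> u = w.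
  rewrite /U /= => Uu Uw wE.
  have wn : lorentz b w = lorentz b u + n%:R * lorentz b b by rewrite wE pow.
  case: n wE wn => [|n] wE wn; first by rewrite wE expg0 isom_fun1.
  exfalso; have : n.+1%:R * lorentz b b <= lorentz b b.
    by rewrite ger_nMl// ler1n.
  move: Uu Uw; rewrite !ltr_norml => /andP[] + + /andP[].
  rewrite wn; move: bT; rewrite /timelike; lra.
have Uinj : {in U &, injective (orbit_proj (cyclic_group psi))}.
  move=> u w /set_mem Uu /set_mem Uw /orbit_projP[h /asboolP[n [->|->]] wE].
    exact: near_eq wE.
  (* For a negative power the two points exchange roles. *)
  by apply/esym; apply: (near_eq _ _ n) => //; rewrite wE -isom_funM mulgV isom_fun1.
have [phi Uphi] := chart_exists Uo Uinj.
exists U, phi; split => //; rewrite /U /= subrr.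
by rewrite normr0; move: bT; rewrite /timelike; lra.
Qed.

Theorem theorem4p2 (R : realType) (psi : mink_isom R)
    (psi_SO0 : SO21_0 (linear_part psi))
    (psi_elliptic : elliptic psi)
    (psi_free : fixed_point_free psi) :
  CTC_preimage (cyclic_group psi) = [set: Minkowski R] /\
  CTC_region (cyclic_group psi) = [set: orbit_space (cyclic_group psi)].
Proof.
have [b [q [bT psib psiE]]] := elliptic_screw psi_SO0 psi_elliptic psi_free.
have CTC p : CTC_preimage (cyclic_group psi) p.
  have [n nT] := screw_displacement bT psib psiE p.
  apply: timelike_translate_CTC nT; first exact: screw_charts psib psiE.
  by apply/asboolP; exists n; left.
split; apply/seteqP; split => // x _.
by have [p <-] := orbit_proj_surj x; exact: CTC.
Qed.
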